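(* Let $\Sigma$ be a finite alphabet containing a symbol $0$ and let $X \subset \Sigma^{\mathbb{Z}}$ be an almost minimal one-dimensional subshift (with fixed point $0^{\mathbb{Z}}$). Then there is a point $x \in X$ that is a finite point or a cluster fractal such that $X$ is the orbit closure of $x$ under the shift.
   Context: A ($\mathbb{Z}^d$-)subshift is a nonempty closed shift-invariant subset of $\Sigma^{\mathbb{Z}^d}$ (product topology), where the shift is $\sigma^{\mathbf v}(x)_{\mathbf u} = x_{\mathbf u + \mathbf v}$ and $\Sigma \ni 0$ is a finite alphabet; symbols other than $0$ are called nonzero. A subshift $X$ is almost minimal if its only closed shift-invariant subsets are $\emptyset$, $X$ and a single one-point set $\{y\} \neq X$; subshifts are pointed with distinguished point $0^{\mathbb{Z}^d}$ (the all-zero configuration), so $y = 0^{\mathbb{Z}^d}$. A finite point is a configuration with only finitely many nonzero cells. Cluster fractals. On $\mathbb{Z}^d$ use $d(\mathbf u,\mathbf v) = \max_i |\mathbf u_i - \mathbf v_i|$, and let $B_r(S)$ be the set of cells at distance at most $r$ from $S$. A pattern is a function $P : D(P) \to \Sigma$ with $D(P) \subset \mathbb{Z}^d$; its support $S(P)$ is the set of cells of $D(P)$ where $P$ is nonzero. A set $S \subset \mathbb{Z}^d$ is $r$-connected if the graph on $S$ with edges between cells at distance at most $r$ is connected. $P$ is $r$-padded if $D(P) \supset B_r(S(P))$. An $r$-cluster is an $r$-padded pattern (with nonempty support) whose support is $r$-connected and all of whose zero cells are at distance at most $r$ from the support. A pattern $R$ is a zero-gluing of patterns $P$ and $Q$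 if $D(R) = D(P)\cup D(Q)$, $R|_{D(P)} = P$, $R|_{D(Q)} = Q$, and $P$, $Q$ are both $0$ on $D(P)\cap D(Q)$ (similarly for finitely many patterns). For a pattern $P$, $P|_{\mathbb{Z}^d}$ is the configuration that agrees with $P$ on $D(P)$ and is $0$ elsewhere. A configuration $x \in \Sigma^{\mathbb{Z}^d}$ is a cluster fractal if it is not all-zero and there are an increasing sequence $r_1 < r_2 < \cdots$ of natural numbers and, for each $i$, a finite set $B_i$ of finite $r_i$-clusters such that for all $i$: (1) each cluster in $B_{i+1}$ is obtained by zero-gluing translates of clusters in $B_i$ and adding the $r_{i+1}$-padding by zeroes; (2) each cluster in $B_{i+1}$ contains a translate of every cluster in $B_i$; (3) each cluster in $B_{i+1}$ contains at least two translates of clusters in $B_i$ with disjoint supports; and (4) $x = \lim_{j\to\infty} \sigma^{\mathbf v_j}(b_j|_{\mathbb{Z}^d})$ for some sequences $\mathbf v_j \in \mathbb{Z}^d$, $b_j \in B_j$. *)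

(* Defs.v *)
From mathcomp Require Import all_boot all_order all_algebra.
From mathcomp Require Import all_classical all_reals all_analysis.

Set Implicit Arguments.
Unset Strict Implicit.
Unset Printing Implicit Defensive.

Import Order.TTheory GRing.Theory Num.Theory.
Local Open Scope classical_set_scope.
Local Open Scope ring_scope.

Definition cell (d : nat) : Type := 'rV[int]_d.

(* Sigma^(Z^d), with the product of the discrete topologies *)
Definition conf (d : nat) (Sigma : finType) : Type :=
  prod_topology (fun _ : cell d => discrete_topology Sigma).

Definition zero_conf (d : nat) (Sigma : finType) (zero : Sigma) :
  conf d Sigma := fun _ => zero.

Arguments zero_conf d {Sigma} zero.

Definition shift_conf (d : nat) (Sigma : finType) (v : cell d)
  (x : conf d Sigma) : conf d Sigma := fun u => x (u + v).

Definition shift_invariant (d : nat) (Sigma : finType)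
  (X : set (conf d Sigma)) : Prop :=
  forall v : cell d, shift_conf v @` X `<=` X.

Definition subshift (d : nat) (Sigma : finType)
  (X : set (conf d Sigma)) : Prop :=
  [/\ X !=set0, closed X & shift_invariant X].

(* [y] is the point of the unique proper nonempty subsystem of [X]. *)
Definition almost_minimal (d : nat) (Sigma : finType)
  (X : set (conf d Sigma)) (y : conf d Sigma) : Prop :=
  subshift X /\ [set y] <> X /\
  forall Y : set (conf d Sigma),
    (Y `<=` X /\ closed Y /\ shift_invariant Y) <->
    (Y = set0 \/ Y = X \/ Y = [set y]).

Definition orbit_closure (d : nat) (Sigma : finType)
  (x : conf d Sigma) : set (conf d Sigma) :=
  closure (range (fun v : cell d => shift_conf v x)).

Definition finite_point (d : nat) (Sigma : finType) (zero : Sigma)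
  (x : conf d Sigma) : Prop :=
  finite_set [set u | x u <> zero].

Definition cell_dist (d : nat) (u v : cell d) : nat :=
  (\max_(i < d) `|u ord0 i - v ord0 i|)%N.

Definition cell_ball (d : nat) (r : nat) (S : set (cell d)) : set (cell d) :=
  [set u | exists2 v, S v & (cell_dist u v <= r)%N].

(* A partial function on Z^d: [P u = None] means that u is not in D(P), so that
   equality of patterns is equality of domains and of values. *)
Definition pattern (d : nat) (Sigma : finType) : Type :=
  cell d -> option Sigma.

Definition dom (d : nat) (Sigma : finType) (P : pattern d Sigma) :
  set (cell d) := [set u | P u <> None].

Definition supp (d : nat) (Sigma : finType) (zero : Sigma)
  (P : pattern d Sigma) : set (cell d) :=
  [set u | exists2 a : Sigma, P u = Some a & a <> zero].

Definition translate (d : nat) (Sigma : finType) (v : cell d)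
  (P : pattern d Sigma) : pattern d Sigma := fun u => P (u + v).

Definition extend (d : nat) (Sigma : finType) (zero : Sigma)
  (P : pattern d Sigma) : conf d Sigma := fun u => odflt zero (P u).

Definition r_connected (d : nat) (r : nat) (S : set (cell d)) : Prop :=
  forall u v : cell d, S u -> S v ->
  exists p : seq (cell d),
    [/\ forall w, w \in p -> S w,
        path (fun a b : cell d => (cell_dist a b <= r)%N) u p
      & last u p = v].

Definition r_padded (d : nat) (Sigma : finType) (zero : Sigma) (r : nat)
  (P : pattern d Sigma) : Prop :=
  cell_ball r (supp zero P) `<=` dom P.

Definition r_cluster (d : nat) (Sigma : finType) (zero : Sigma) (r : nat)
  (P : pattern d Sigma) : Prop :=
  [/\ r_padded zero r P,
      supp zero P !=set0,
      r_connected r (supp zero P)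
    & forall u, P u = Some zero -> cell_ball r (supp zero P) u].

(* [Q] is the restriction of [P] to D(Q). *)
Definition subpattern (d : nat) (Sigma : finType)
  (Q P : pattern d Sigma) : Prop :=
  forall u, dom Q u -> P u = Q u.

Definition zero_gluing (d : nat) (Sigma : finType) (zero : Sigma) (n : nat)
  (P : 'I_n -> pattern d Sigma) (R : pattern d Sigma) : Prop :=
  [/\ dom R = \bigcup_(k in [set: 'I_n]) dom (P k),
      forall k, subpattern (P k) R
    & forall k l u, k <> l -> dom (P k) u -> dom (P l) u ->
        P k u = Some zero /\ P l u = Some zero].

Definition zero_pad (d : nat) (Sigma : finType) (zero : Sigma) (r : nat)
  (R : pattern d Sigma) : pattern d Sigma :=
  fun u => match R u with
           | Some a => Some a
           | None => if u \in cell_ball r (supp zero R) then Some zero else None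
           end.

Definition cluster_fractal (d : nat) (Sigma : finType) (zero : Sigma)
  (x : conf d Sigma) : Prop :=
  x <> zero_conf d zero /\
  exists (r : nat -> nat) (B : nat -> set (pattern d Sigma)),
  [/\ forall i, (r i < r i.+1)%N,
      forall i, finite_set (B i),
      forall i b, B i b -> finite_set (dom b) /\ r_cluster zero (r i) b
    & [/\ forall i b, B i.+1 b ->
            exists (n : nat) (c : 'I_n -> pattern d Sigma)
                   (v : 'I_n -> cell d) (R : pattern d Sigma),
              [/\ forall k, B i (c k),
                  zero_gluing zero (fun k => translate (v k) (c k)) R
                & b = zero_pad zero (r i.+1) R],
          forall i b c, B i.+1 b -> B i c ->
            exists v : cell d, subpattern (translate v c) b,
          forall i b, B i.+1 b ->
            exists (c1 c2 : pattern d Sigma) (v1 v2 : cell d),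
              [/\ B i c1, B i c2,
                  subpattern (translate v1 c1) b,
                  subpattern (translate v2 c2) b
                & supp zero (translate v1 c1) `&` supp zero (translate v2 c2)
                  = set0]
        & exists (v : nat -> cell d) (b : nat -> pattern d Sigma),
            (forall j, B j (b j)) /\
            (fun j => shift_conf (v j) (extend zero (b j))) @ \oo --> x]].

(* Main.v *)
Require Import Defs.
From mathcomp Require Import all_boot all_order all_algebra.
From mathcomp Require Import all_classical all_reals all_analysis.
From mathcomp Require Import zify.

(** Every nonzero point [x] of an almost minimal subshift [X] is transitive: its
orbit closure is a closed invariant subset of [X] containing [x], hence is [X].
So if [X] has a nonzero finite point, that point is the answer, and otherwise
it is enough to see that a nonzero point is a cluster fractal; in fact all of
them are.

Fix [r] and cut the support of a point into its classes under steps of length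
at most [r]; each class, with its padding of width [r], is an [r]-cluster.

- In dimension one these clusters are uniformly bounded
  ([bounded_components]). A limit of a point pushed far to the right has [0] in
  its orbit closure, because every nonempty subsystem contains [0]; so the point
  itself has arbitrarily long runs of zeros arbitrarily far to the right, and
  likewise to the left. A run of [r] zeros on each side confines a class, and
  compactness makes the bound uniform. Hence up to translation there are
  finitely many [r]-clusters; they form the set [clusters r].

- A class at scale [n] contains every nonzero cell at distance at most [n] from
  any of its cells. Since each nonzero point contains every pattern of [X], and,
  when there is no nonzero finite point, has nonzero cells outside any bounded
  window, compactness gives: for large [n], every [n]-cluster contains a copy of
  every [r]-cluster ([clusters_occur_eventually]) and is not reduced to a single
  [r]-cluster ([clusters_split_eventually]).

- Whenever [r <= r'], an [r']-cluster is the padded zero-gluing of the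
  [r]-clusters it meets ([cluster_at_zero_gluing]).

Choosing scales [r_0 < r_1 < ...] along which the second item applies gives the
required family. The clusters of a fixed nonzero cell [p] of [x] converge to
[x], since the one at scale [r] agrees with [x] on the ball of radius [r]
about [p]. Only the uniform bound uses the dimension, so the rest is proved in
any dimension with the bound as a hypothesis ([cluster_fractal_of_bounded]). *)

Set Implicit Arguments.
Unset Strict Implicit.
Unset Printing Implicit Defensive.

Import Order.TTheory GRing.Theory Num.Theory.
Local Open Scope classical_set_scope.
Local Open Scope ring_scope.

(** * Cylinders, compactness and orbit closures *)

Section Configurations.
Context {d : nat} {Sigma : finType}.
Implicit Types (x y : conf d Sigma) (u v w : cell d) (W : seq (cell d)).

Definition agree W x y := forall u, u \in W -> y u = x u.

Lemma near_agree W x : \forall y \near x, agree W x y.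
Proof.
elim: W => [|u W IH]; first by near=> y => u.
have xu : \forall y \near x, y u = x u.
  have := @proj_continuous _ (fun _ : cell d => discrete_topology Sigma) u x.
  by move=> /(_ _ (discrete_set1 _)).
near=> y => v; rewrite inE => /orP[/eqP ->|]; first by near: y.
by move: v; near: y.
Unshelve. all: by end_near. Qed.

(** The product topology is an initial topology, so convergence of the filter of
cylinders can be tested cell by cell; this is the cheap way to see that the
cylinders form a neighbourhood basis. *)
Lemma cylinder_basis_cvg x :
  filter_from [set: seq (cell d)] (fun W => [set y | agree W x y]) --> x.
Proof.
set F := filter_from _ _.
have FF : Filter F.
  apply: filter_from_filter; first by exists [::].
  move=> V W _ _; exists (V ++ W) => // y yVW; split=> u uW; apply: yVW;
    by rewrite mem_cat uW ?orbT.
apply/cvg_sup => u.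
apply/cvg_image.
  by apply/seteqP; split=> // a _; exists (fun=> a).
move=> A; rewrite nbhs_principalE => /principal_filterP Axu.
exists ((fun y : conf d Sigma => y u) @^-1` A); last first.
  by apply/seteqP; split=> [_ [y Ay <-] //|a Aa]; exists (fun=> a).
by exists [:: u] => // y /(_ u); rewrite inE eqxx /= => ->.
Qed.

Lemma nbhs_agree x (A : set (conf d Sigma)) :
  nbhs x A -> exists W, [set y | agree W x y] `<=` A.
Proof. by move=> /cylinder_basis_cvg [W _ WA]; exists W. Qed.

Lemma orbit_closureP x y :
  orbit_closure x y <-> forall W, exists v, agree W y (shift_conf v x).
Proof.
split=> [xy W|xy A /nbhs_agree[W WA]].
  by have [_ [[v _ <-] vW]] := xy _ (near_agree W y); exists v.
by have [v vW] := xy W; exists (shift_conf v x); split; [exists v|exact: WA].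
Qed.

Lemma conf_compact : compact [set: conf d Sigma].
Proof.
have := @tychonoff (cell d) (fun=> discrete_topology Sigma) (fun=> setT).
rewrite (_ : [set f : forall i, discrete_topology Sigma | _] = setT).
  by apply=> u; apply: finite_compact; exact: (@finite_finset Sigma setT).
by apply/seteqP; split.
Qed.

Lemma closed_conf_compact (X : set (conf d Sigma)) : closed X -> compact X.
Proof. by move=> Xc; exact: subclosed_compact Xc conf_compact _. Qed.

(** The form in which compactness is used throughout: a property that holds for
large [n] on a cylinder about each point holds for large [n] uniformly. *)
Lemma closed_eventually (X : set (conf d Sigma))
    (P : nat -> conf d Sigma -> Prop) :
  closed X ->
  (forall x, X x -> exists W N, forall y n,
     X y -> agree W x y -> (N <= n)%N -> P n y) ->
  exists N, forall n x, (N <= n)%N -> X x -> P n x.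
Proof.
move=> Xc XP.
have /compact_near_coveringP/near_covering_withinP cov :=
  closed_conf_compact Xc.
have [|N _ NP] := cov nat \oo P _; last first.
  by exists N => n x Nn Xx; exact: NP.
move=> x /XP[W [N WN]].
exists ([set y | agree W x y], [set n | (N <= n)%N]) => /=.
  by split; [exact: near_agree|exists N].
by move=> [y n] /= [yW Nn] Xy; exact: WN.
Qed.

Lemma shift_confD v w x : shift_conf v (shift_conf w x) = shift_conf (v + w) x.
Proof. by apply/funext => u; rewrite /shift_conf addrA. Qed.

Lemma shift_conf0 x : shift_conf 0 x = x.
Proof. by apply/funext => u; rewrite /shift_conf addr0. Qed.

Lemma orbit_closure_shift_invariant x : shift_invariant (orbit_closure x).
Proof.
move=> v _ [y xy <-]; apply/orbit_closureP => W.
have /orbit_closureP /(_ [seq u + v | u <- W])[w wW] := xy.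
exists (v + w) => u uW; rewrite -shift_confD.
exact: (wW (u + v) (map_f (fun u => u + v) uW)).
Qed.

Lemma orbit_closure_refl x : orbit_closure x x.
Proof. by apply: subset_closure; exists 0 => //; exact: shift_conf0. Qed.

Lemma orbit_closure_sub (X : set (conf d Sigma)) x :
  closed X -> shift_invariant X -> X x -> orbit_closure x `<=` X.
Proof.
move=> Xc Xs Xx; rewrite [X in _ `<=` X]((closure_id X).1 Xc).
by apply: closure_subset => _ [v _ <-]; apply: (Xs v); exists x.
Qed.

End Configurations.

(** * Almost minimal subshifts *)

Section AlmostMinimal.
Context {d : nat} {Sigma : finType} {zero : Sigma} {X : set (conf d Sigma)}.
Hypothesis Xam : almost_minimal X (zero_conf d zero).

Let Xc : closed X. Proof. by case: Xam => -[]. Qed.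
Let Xs : shift_invariant X. Proof. by case: Xam => -[]. Qed.

Lemma almost_minimal_shift v x : X x -> X (shift_conf v x).
Proof. by move=> Xx; apply: Xs; exists x. Qed.

Lemma almost_minimal_orbit_closure x : X x -> orbit_closure x `<=` X.
Proof. exact: orbit_closure_sub. Qed.

Lemma almost_minimal_zero : X (zero_conf d zero).
Proof.
case: Xam => _ [_ /(_ [set zero_conf d zero])[_ H]].
by have [sX _] := H (or_intror (or_intror erefl)); apply: sX.
Qed.

Lemma almost_minimal_orbit_closure_cases x : X x ->
  orbit_closure x = X \/ orbit_closure x = [set zero_conf d zero].
Proof.
move=> Xx; case: Xam => _ [_ /(_ (orbit_closure x))[H _]].
case: H => [|x0|]; [|by have := @orbit_closure_refl _ _ x; rewrite x0|exact].
split; first exact: almost_minimal_orbit_closure.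
by split; [exact: closed_closure|exact: orbit_closure_shift_invariant].
Qed.

Lemma almost_minimal_transitive x :
  X x -> x <> zero_conf d zero -> orbit_closure x = X.
Proof.
move=> /almost_minimal_orbit_closure_cases[//|x0 xN0].
by have := @orbit_closure_refl _ _ x; rewrite x0.
Qed.

Lemma almost_minimal_nonzero : exists2 x, X x & x <> zero_conf d zero.
Proof.
case: Xam => _ [XN0 _]; apply: contrapT => nX; apply: XN0.
apply/seteqP; split=> [_ -> |x Xx]; first exact: almost_minimal_zero.
by apply: contrapT => xN0; apply: nX; exists x.
Qed.

(** Far along the direction [e], every point of [X] vanishes on translates of any
finite window. A limit point [y] of the translates [shift_conf (e *+ k) x] has
the zero configuration in its orbit closure, so [y] vanishes on some translate
[W + v] of the window, and [shift_conf (e *+ k) x] agrees with [y] there for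
infinitely many [k]. The offset [v] does not depend on [n], so [n] can be taken
large compared with it. *)
Lemma almost_minimal_zero_windows x (W : seq (cell d)) (e : cell d) : X x ->
  exists v, forall n, exists2 k, (n <= k)%N &
    forall u, u \in W -> x (u + v + e *+ k) = zero.
Proof.
move=> Xx; pose F := (fun k => shift_conf (e *+ k) x) @ \oo.
have FX : F X by exists 0%N => // k _; exact: almost_minimal_shift.
have [y [Xy Fy]] := closed_conf_compact Xc _ FX.
have : orbit_closure y (zero_conf d zero).
  case: (almost_minimal_orbit_closure_cases Xy) => -> //.
  exact: almost_minimal_zero.
move=> /orbit_closureP /(_ W)[v vW]; exists v => n.
have Fn : F [set z | exists2 k, (n <= k)%N & z = shift_conf (e *+ k) x].
  by exists n => // k nk; exists k.
have [z [[k nk ->] zy]] := Fy _ _ Fn (near_agree [seq u + v | u <- W] y).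
exists k => // u uW; have := zy _ (map_f (fun u => u + v) uW).
by rewrite /shift_conf => ->; exact: vW.
Qed.

End AlmostMinimal.

(** * Classes of cells under bounded steps *)

Section Cells.
Context {d : nat}.
Implicit Types (u v w p : cell d) (S : set (cell d)).

Lemma cell_dist_leP u v r :
  reflect (forall i, (`|u ord0 i - v ord0 i| <= r)%N) (cell_dist u v <= r)%N.
Proof. by apply: (iffP (bigmax_leqP _ _ _)) => H i *; exact: H. Qed.

Lemma cell_distxx u : cell_dist u u = 0%N.
Proof. by apply/eqP; rewrite -leqn0; apply/cell_dist_leP => i; lia. Qed.

Lemma cell_distC u v : cell_dist u v = cell_dist v u.
Proof. by apply: eq_bigr => i _; lia. Qed.

Lemma cell_dist_triangle v u w :
  (cell_dist u w <= cell_dist u v + cell_dist v w)%N.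
Proof.
apply/cell_dist_leP => i.
have /cell_dist_leP/(_ i) := leqnn (cell_dist u v).
have /cell_dist_leP/(_ i) := leqnn (cell_dist v w).
lia.
Qed.

Lemma cell_distD u v w : cell_dist (u + w) (v + w) = cell_dist u v.
Proof. by apply: eq_bigr => i _; rewrite !mxE opprD addrACA subrr addr0. Qed.

Lemma cell_ball_finite N : finite_set (cell_ball N [set 0 : cell d]).
Proof.
pose f (M : 'rV['I_(N.*2.+1)]_d) : cell d := \row_i ((M ord0 i)%:Z - N%:Z).
apply: (@sub_finite_set _ _ (range f)); last first.
  by apply: finite_image; exact: finite_finset.
move=> u [_ -> /cell_dist_leP u0].
exists (\row_i inord `|u ord0 i + N%:Z|) => //.
apply/rowP => i; rewrite !mxE.
have := u0 i; rewrite mxE (_ : ord0 = 0) // => ui.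
by rewrite inordK; lia.
Qed.

Lemma sub_cell_ball r S : S `<=` cell_ball r S.
Proof. by move=> u Su; exists u => //; rewrite cell_distxx. Qed.

Lemma cell_ballS r r' S S' : (r <= r')%N -> S `<=` S' ->
  cell_ball r S `<=` cell_ball r' S'.
Proof.
by move=> rr' SS' u [v Sv uv]; exists v; [exact: SS'|exact: leq_trans rr'].
Qed.

Lemma cell_ball_ball r r' S :
  cell_ball r (cell_ball r' S) `<=` cell_ball (r + r') S.
Proof.
move=> u [v [w Sw vw] uv]; exists w => //.
by apply: leq_trans (cell_dist_triangle v u w) _; exact: leq_add.
Qed.

Definition link r S u v := exists p : seq (cell d),
  [/\ forall w, w \in p -> S w,
      path (fun a b : cell d => (cell_dist a b <= r)%N) u p
    & last u p = v].

Lemma link_refl r S u : link r S u u.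
Proof. by exists [::]. Qed.

(** Paths are extended and consumed at their end ([link_step], [link_ind]), so
that every later fact about [link] follows without manipulating sequences. *)
Lemma link_step r S u v w :
  link r S u v -> S w -> (cell_dist v w <= r)%N -> link r S u w.
Proof.
move=> [p [pS pu <-]] Sw vw; exists (rcons p w); split.
- by move=> a; rewrite mem_rcons inE => /orP[/eqP ->//|/pS].
- by rewrite rcons_path pu.
- by rewrite last_rcons.
Qed.

Lemma link_ind r S u (A : cell d -> Prop) : A u ->
  (forall v w, A v -> S w -> (cell_dist v w <= r)%N -> A w) ->
  forall v, link r S u v -> A v.
Proof.
move=> Au AS v [p [pS pu <-]]; elim: p u Au pS pu => //= a p IH u Au pS.
move=> /andP[ua ap]; apply: IH => //.
  by apply: AS ua => //; apply: pS; rewrite inE eqxx.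
by move=> w wp; apply: pS; rewrite inE wp orbT.
Qed.

Lemma link_trans r S u v w : link r S u v -> link r S v w -> link r S u w.
Proof. by move=> uv; elim/link_ind: w / => // a b; exact: link_step. Qed.

Lemma link_mem r S u v : S u -> link r S u v -> S v.
Proof. by move=> Su; elim/link_ind: v /. Qed.

Lemma link_sym r S u v : S u -> link r S u v -> link r S v u.
Proof.
move=> Su uv; suff [] : S v /\ link r S v u by [].
elim/link_ind: v / uv => [|v w [Sv vu] Sw vw].
  by split=> //; exact: link_refl.
split=> //; apply: link_trans vu; apply: link_step (link_refl _ _ _) Sv _.
by rewrite cell_distC.
Qed.

Lemma linkS r r' S u v : (r <= r')%N -> link r S u v -> link r' S u v.
Proof.
move=> rr'; elim/link_ind: v / => [|v w uv Sw vw]; first exact: link_refl.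
by apply: link_step uv Sw _; exact: leq_trans rr'.
Qed.

Lemma link_translate r S u v w :
  link r S u v -> link r [set a | S (a + w)] (u - w) (v - w).
Proof.
elim/link_ind: v / => [|a b ua Sb ab]; first exact: link_refl.
by apply: link_step ua _ _; rewrite /= ?subrK ?cell_distD.
Qed.

Lemma link_translateE r S u v w :
  link r [set a | S (a + w)] u v = link r S (u + w) (v + w).
Proof.
apply/propext; split=> [/link_translate-/(_ (- w))|/link_translate-/(_ w)].
  rewrite !opprK; congr (link _ _ _ _).
  by apply/funext => a /=; rewrite subrK.
by rewrite !addrK.
Qed.

(** The prefixes of a path stay in the class of its origin, so two cells of a
class are joined inside the class. *)
Lemma link_in_component r S p u v :
  link r S p u -> link r S u v -> link r (link r S p) u v.
Proof.
move=> pu uv; suff [] : link r S p v /\ link r (link r S p) u v by [].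
elim/link_ind: v / uv => [|v w [pv uv] Sw vw].
  by split=> //; exact: link_refl.
have pw := link_step pv Sw vw.
by split=> //; exact: link_step uv pw vw.
Qed.

Lemma component_r_connected r S p : S p -> r_connected r (link r S p).
Proof.
move=> Sp u v pu pv; apply: (link_in_component pu).
exact: link_trans (link_sym Sp pu) pv.
Qed.

Lemma component_eq r S p q : S p -> link r S p q -> link r S p = link r S q.
Proof.
move=> Sp pq; apply/seteqP; split=> u; last exact: link_trans.
by apply: link_trans; exact: link_sym.
Qed.

(** A class absorbs all cells of [S] within reach of it; this is why two
neighbouring clusters overlap in zeros only, and why padding adds only
zeros. *)
Lemma cell_ball_component r S p u :
  S u -> cell_ball r (link r S p) u -> link r S p u.
Proof.
by move=> Su [v pv uv]; apply: link_step pv Su _; rewrite cell_distC.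
Qed.

End Cells.

(** * Clusters of a configuration *)

Section Patterns.
Context {d : nat} {Sigma : finType} (zero : Sigma).
Implicit Types (x y : conf d Sigma) (u v w p : cell d) (S D : set (cell d)).

Definition nonzero x : set (cell d) := [set u | x u <> zero].

Definition restriction x D : pattern d Sigma :=
  fun u => if u \in D then Some (x u) else None.

(** For a nonzero cell [p], the set [link r (nonzero x) p] is the class of [p], so
this is the [r]-cluster of [x] containing [p], cut out together with its
padding. *)
Definition cluster_at r x p : pattern d Sigma :=
  restriction x (cell_ball r (link r (nonzero x) p)).

Lemma restriction_in x D u : D u -> restriction x D u = Some (x u).
Proof. by move=> Du; rewrite /restriction mem_set. Qed.

Lemma restriction_out x D u : ~ D u -> restriction x D u = None.
Proof. by move=> Du; rewrite /restriction memNset. Qed.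

Lemma dom_restriction x D : dom (restriction x D) = D.
Proof.
apply/seteqP; split=> u; rewrite /dom /=.
  by move=> xu; apply: contrapT => Du; apply: xu; exact: restriction_out.
by move=> Du; rewrite restriction_in.
Qed.

Lemma supp_restriction x D : supp zero (restriction x D) = D `&` nonzero x.
Proof.
apply/seteqP; split=> u; rewrite /supp /=.
  move=> [a]; have [Du|Du] := pselect (D u).
    by rewrite restriction_in // => -[<-].
  by rewrite restriction_out.
by move=> [Du xu]; exists (x u) => //; exact: restriction_in.
Qed.

Lemma subpattern_restriction x D D' :
  D `<=` D' -> subpattern (restriction x D) (restriction x D').
Proof.
move=> DD' u; rewrite dom_restriction => Du.
by rewrite !restriction_in //; exact: DD'.
Qed.

Lemma translate_restriction v x D :
  translate v (restriction x D) =
    restriction (shift_conf v x) [set u | D (u + v)].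
Proof.
apply/funext => u; have [Du|Du] := pselect (D (u + v)).
  by rewrite /translate !restriction_in.
by rewrite /translate !restriction_out.
Qed.

Lemma supp_cluster_at r x p : nonzero x p ->
  supp zero (cluster_at r x p) = link r (nonzero x) p.
Proof.
move=> xp; rewrite supp_restriction; apply/seteqP; split=> u.
  by move=> [pu xu]; exact: cell_ball_component.
by move=> pu; split; [exact: sub_cell_ball|exact: link_mem pu].
Qed.

Lemma cluster_at_r_cluster r x p :
  nonzero x p -> r_cluster zero r (cluster_at r x p).
Proof.
move=> xp; rewrite /r_cluster /r_padded supp_cluster_at // dom_restriction.
split=> //.
- by exists p; exact: link_refl.
- exact: component_r_connected.
- move=> u; have [//|Nu] := pselect (cell_ball r (link r (nonzero x) p) u).
  by rewrite /cluster_at restriction_out.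
Qed.

Lemma nonzero_shift v x :
  nonzero (shift_conf v x) = [set u | nonzero x (u + v)].
Proof. by []. Qed.

Lemma translate_cluster_at r v x p :
  translate v (cluster_at r x (p + v)) = cluster_at r (shift_conf v x) p.
Proof.
rewrite /cluster_at translate_restriction; congr restriction.
apply/seteqP; split=> u /=.
  move=> [w pw uw]; exists (w - v).
    by rewrite nonzero_shift /= link_translateE subrK.
  by rewrite -(cell_distD _ _ v) subrK.
move=> [w pw uw]; exists (w + v); last by rewrite cell_distD.
by rewrite -link_translateE -nonzero_shift.
Qed.

Lemma cluster_at_centred r x p :
  cluster_at r x p = translate (- p) (cluster_at r (shift_conf p x) 0).
Proof.
have := translate_cluster_at r (- p) (shift_conf p x) p.
by rewrite subrr shift_confD addNr shift_conf0.
Qed.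

End Patterns.

(** * Gluing clusters of a smaller scale *)

Section Decomposition.
Context {d : nat} {Sigma : finType} (zero : Sigma).
Implicit Types (x y : conf d Sigma) (u v w p : cell d) (S D : set (cell d)).

Lemma cvg_agree (f : nat -> conf d Sigma) x :
  (forall W, exists N, forall n, (N <= n)%N -> agree W x (f n)) ->
  f @ \oo --> x.
Proof.
move=> fx A /nbhs_agree[W WA]; have [N NW] := fx W.
by exists N => // n /NW; exact: WA.
Qed.

(** A pattern defined inside a finite set is the list of its values there. *)
Lemma finite_patterns D : finite_set D ->
  finite_set [set P : pattern d Sigma | forall u, ~ D u -> P u = None].
Proof.
move=> /finite_seqP[s ->].
pose g (t : (size s).-tuple (option Sigma)) : pattern d Sigma :=
  fun u => nth None t (index u s).
apply: (@sub_finite_set _ _ (range g)); last first.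
  by apply: finite_image; exact: finite_finset.
move=> P PD; exists (map_tuple P (in_tuple s)) => //.
apply/funext => u; rewrite /g /=.
have [us|/negP us] := boolP (u \in s).
  by rewrite (nth_map u) ?index_mem // nth_index.
by rewrite PD // nth_default // size_map leqNgt index_mem; exact/negP.
Qed.

(** The pieces are the [r]-clusters at the cells of the [r']-class of [p]. Several
cells give the same piece, and a gluing must list each piece once, so the pieces
are enumerated as patterns and then a base cell [q k] is chosen in each. *)
Lemma cluster_at_zero_gluing r r' x p :
  (r <= r')%N -> nonzero zero x p -> finite_set (link r' (nonzero zero x) p) ->
  exists (n : nat) (q : 'I_n -> cell d) (R : pattern d Sigma),
    [/\ forall k, nonzero zero x (q k),
        zero_gluing zero (fun k => cluster_at zero r x (q k)) R
      & cluster_at zero r' x p = zero_pad zero r' R].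
Proof.
move=> rr' xp; set S := link r' _ p => Sfin.
have Sx q : S q -> nonzero zero x q by exact: link_mem.
have subS q : S q -> link r (nonzero zero x) q `<=` S.
  by move=> Sq u qu; apply: link_trans Sq _; exact: linkS qu.
have /finite_seqP[s0 s0E] := finite_image (cluster_at zero r x) Sfin.
pose s := undup s0.
have [k|q qs] := @choice 'I_(size s) (cell d)
    (fun k u => S u /\ cluster_at zero r x u = tnth (in_tuple s) k).
  have : [set` s0] (tnth (in_tuple s) k) by rewrite /= -mem_undup mem_tnth.
  by rewrite -s0E => -[u Su <-]; exists u.
have qinj k l : cluster_at zero r x (q k) = cluster_at zero r x (q l) -> k = l.
  rewrite !(qs _).2 => /eqP; rewrite !(tnth_nth (fun=> None)) /=.
  by rewrite nth_uniq ?undup_uniq // => /eqP/val_inj.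
have qsurj u : S u ->
    exists k, cluster_at zero r x (q k) = cluster_at zero r x u.
  move=> Su; have : cluster_at zero r x u \in s.
    rewrite mem_undup; suff : [set` s0] (cluster_at zero r x u) by [].
    by rewrite -s0E; exists u.
  rewrite -index_mem => us; exists (Ordinal us).
  rewrite (qs _).2 (tnth_nth (cluster_at zero r x u)) /=.
  by rewrite nth_index // -index_mem.
exists (size s), q, (restriction x (cell_ball r S)); split.
- by move=> k; apply: Sx; exact: (qs k).1.
- split.
  + rewrite dom_restriction; apply/seteqP; split=> u.
      move=> [v Sv uv]; have [k kv] := qsurj v Sv; exists k => //.
      rewrite kv dom_restriction; exists v => //; exact: link_refl.
    move=> [k _]; rewrite dom_restriction; apply: cell_ballS => //.
    by apply: subS; exact: (qs k).1.
  + move=> k; apply: subpattern_restriction; apply: cell_ballS => //.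
    by apply: subS; exact: (qs k).1.
  (* A nonzero common cell would belong to both classes, and the pieces would be
     equal. *)
  + move=> k l u kl; rewrite !dom_restriction => ku lu.
    rewrite /cluster_at !restriction_in //.
    suff xu : x u = zero by rewrite xu.
    apply: contrapT => xu; apply: kl; apply: qinj.
    have kx := Sx _ (qs k).1; have lx := Sx _ (qs l).1.
    have := cell_ball_component xu ku; have := cell_ball_component xu lu.
    move=> lu' ku'; congr restriction; congr cell_ball.
    by rewrite (component_eq kx ku') (component_eq lx lu').
- apply/funext => u; rewrite /zero_pad supp_restriction.
  have [Su|Su] := pselect (cell_ball r S u).
    rewrite [restriction x (cell_ball r S) u]restriction_in //.
    by rewrite /cluster_at restriction_in //; exact: cell_ballS Su.
  rewrite [restriction x (cell_ball r S) u]restriction_out //.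
  rewrite (_ : _ `&` _ = S); last first.
    apply/seteqP; split=> v; last first.
      by move=> Sv; split; [exact: sub_cell_ball|exact: Sx].
    by move=> [Sv xv]; apply: cell_ball_component xv _; exact: cell_ballS Sv.
  rewrite /cluster_at /restriction -/S; case: ifPn => // /set_mem Su'.
  congr Some; apply: contrapT => xu; apply: Su; apply: sub_cell_ball.
  exact: cell_ball_component xu Su'.
Qed.

End Decomposition.

(** * Subshifts with bounded clusters *)

Lemma finite_eventually (T : choiceType) (C : set T) (Q : nat -> T -> Prop) :
  finite_set C ->
  (forall c, C c -> exists N, forall n, (N <= n)%N -> Q n c) ->
  exists N, forall n c, (N <= n)%N -> C c -> Q n c.
Proof.
move=> /finite_seqP[s ->] CQ.
have [c|N NQ] := @choice T nat
    (fun c N => c \in s -> forall n, (N <= n)%N -> Q n c).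
  have [cs|] := boolP (c \in s); last by exists 0%N.
  by have [N NQ] := CQ c cs; exists N.
exists (\max_(c <- s) N c)%N => n c sn cs; apply: NQ => //.
by apply: leq_trans sn; exact: (@leq_bigmax_seq _ s xpredT N).
Qed.

Section Fractal.
Context {d : nat} {Sigma : finType} {zero : Sigma} {X : set (conf d Sigma)}.
Hypothesis Xam : almost_minimal X (zero_conf d zero).
Local Notation nz := (nonzero zero).
Hypothesis Xbounded : forall r, exists L, forall x, X x -> nz x 0 ->
  link r (nz x) 0 `<=` cell_ball L [set 0].
Hypothesis Xinfinite : forall x,
  X x -> x <> zero_conf d zero -> ~ finite_point zero x.

Let Xc : closed X. Proof. by case: Xam => -[]. Qed.

(** Up to translation these are all the [r]-clusters occurring in [X]: a cluster
may be moved so that any given cell of its support is the origin. *)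
Definition clusters r : set (pattern d Sigma) :=
  [set b | exists x, [/\ X x, nz x 0 & b = cluster_at zero r x 0]].

Let component_finite r x : X x -> nz x 0 -> finite_set (link r (nz x) 0).
Proof.
move=> Xx x0; have [L LX] := Xbounded r.
by apply: sub_finite_set (LX x Xx x0) _; exact: cell_ball_finite.
Qed.

Lemma clusters_finite r : finite_set (clusters r).
Proof.
have [L LX] := Xbounded r.
have Pfin := @finite_patterns d Sigma _ (@cell_ball_finite d (r + L)).
apply: (sub_finite_set _ Pfin).
move=> _ [x [Xx x0 ->]] u Nu; apply: restriction_out => ux; apply: Nu.
by apply: cell_ball_ball; apply: cell_ballS ux => //; exact: LX.
Qed.

Lemma finite_dom_cluster_at r x :
  X x -> nz x 0 -> finite_set (dom (cluster_at zero r x 0)).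
Proof.
move=> Xx x0; have [L LX] := Xbounded r.
apply: (sub_finite_set _ (cell_ball_finite (r + L))).
rewrite dom_restriction => u ux.
by apply: cell_ball_ball; apply: cell_ballS ux => //; exact: LX.
Qed.

Lemma nonzero_conf x u : nz x u -> x <> zero_conf d zero.
Proof. by move=> + x0; rewrite x0. Qed.

(** A point [x] contains a copy of [c]; once [n] is at least the distance from the
origin to the nonzero cells of that copy, they are all one step away from the
origin, so the [n]-cluster at the origin contains the copy with its padding.
The same holds for the points agreeing with [x] on that copy. *)
Lemma clusters_occur_eventually r c : clusters r c ->
  exists N, forall n x, (N <= n)%N -> X x -> nz x 0 ->
    exists v, subpattern (translate v c) (cluster_at zero n x 0).
Proof.
move=> [y [Xy y0 ->]].
have /finite_seqP[W] := finite_dom_cluster_at r Xy y0.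
rewrite dom_restriction => WE.
have WP u : cell_ball r (link r (nz y) 0) u <-> u \in W by rewrite WE.
apply: closed_eventually => // x Xx.
have [x0|Nx0] := pselect (nz x 0); last first.
  exists [:: 0], 0%N => x' n Xx' xx' _ x'0; exfalso; apply: Nx0.
  by rewrite /nonzero /= -(xx' 0) ?mem_head.
have /orbit_closureP /(_ W)[v vW] : orbit_closure x y.
  by rewrite (almost_minimal_transitive Xam Xx (nonzero_conf x0)).
exists [seq u + v | u <- W], (maxn r (\max_(u <- W) cell_dist 0%R (u + v)%R)).
move=> x' n Xx' xx'; rewrite geq_max => /andP[rn Wn] x'0.
have x'v u : u \in W -> x' (u + v) = y u.
  move=> uW; rewrite (xx' (u + v)); first exact: vW.
  exact: (map_f (fun u => u + v)).
exists (- v); rewrite translate_restriction => u.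
rewrite dom_restriction => ru; rewrite restriction_in //.
have uW : u - v \in W by apply/WP.
rewrite /cluster_at restriction_in.
  by rewrite /shift_conf -(x'v _ uW) subrK.
case: ru => w yw uw; exists (w + v); last first.
  by apply: leq_trans rn; rewrite -(cell_distD _ _ (- v)) addrK.
have wW : w \in W by apply/WP; exact: sub_cell_ball.
apply: (link_step (link_refl _ _ _)).
  by rewrite /nonzero /= x'v //; exact: link_mem yw.
apply: leq_trans Wn.
exact: (@leq_bigmax_seq _ W xpredT (fun u => cell_dist 0%R (u + v)%R)).
Qed.

(** As no nonzero point is finite, [x] has a nonzero cell outside the window that
contains all classes of scale [r] through the origin; it is one step of length
[n] away from the origin when [n] is large. *)
Lemma clusters_split_eventually r :
  exists N, forall n x, (N <= n)%N -> X x -> nz x 0 ->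
    exists q, [/\ nz x q, link n (nz x) 0 q & ~ link r (nz x) 0 q].
Proof.
have [L LX] := Xbounded r; apply: closed_eventually => // x Xx.
have [x0|Nx0] := pselect (nz x 0); last first.
  exists [:: 0], 0%N => x' n Xx' xx' _ x'0; exfalso; apply: Nx0.
  by rewrite /nonzero /= -(xx' 0) ?mem_head.
have [q [xq Lq]] : exists q, nz x q /\ ~ cell_ball L [set 0] q.
  apply: contrapT => Nq; apply: (Xinfinite Xx (nonzero_conf x0)).
  apply: (sub_finite_set _ (cell_ball_finite L)) => q xq.
  by apply: contrapT => Lq; apply: Nq; exists q.
exists [:: q], (cell_dist 0 q) => x' n Xx' xx' qn x'0.
have x'q : nz x' q by rewrite /nonzero /= (xx' q) ?mem_head.
exists q; split => //; last by move/(LX _ Xx' x'0).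
exact: link_step (link_refl _ _ _) x'q qn.
Qed.

(** The split is recorded by a cell [q] of the larger cluster outside the smaller
one; the [r]-clusters at the origin and at [q] then have disjoint supports. *)
Lemma next_scale r : exists r', (r < r')%N /\ forall x, X x -> nz x 0 ->
  (forall c, clusters r c ->
    exists v, subpattern (translate v c) (cluster_at zero r' x 0)) /\
  exists q, [/\ nz x q, link r' (nz x) 0 q & ~ link r (nz x) 0 q].
Proof.
have [N2 N2P] := clusters_split_eventually r.
have [|N1 N1P] := @finite_eventually _ _
  (fun n c => forall x, X x -> nz x 0 ->
    exists v, subpattern (translate v c) (cluster_at zero n x 0))
  (clusters_finite r).
  by move=> c /clusters_occur_eventually[N NP]; exists N => n Nn x; exact: NP.
exists (maxn r.+1 (maxn N1 N2)); split; first by rewrite leq_max leqnn.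
move=> x Xx x0; split=> [c rc|].
  by apply: N1P => //; lia.
by apply: N2P => //; lia.
Qed.

Lemma cluster_fractal_of_bounded x :
  X x -> x <> zero_conf d zero -> cluster_fractal zero x.
Proof.
move=> Xx xN0; split=> //.
have [p xp] : exists p, nz x p.
  apply: contrapT => Np; apply: xN0; apply/funext => p.
  by apply: contrapT => xp; apply: Np; exists p.
have [f fP] := choice next_scale.
pose r i := iter i f 0%N.
have rS i : (r i < r i.+1)%N by exact: (fP (r i)).1.
have r_ge j : (j <= r j)%N.
  by elim: j => // j IH; exact: leq_ltn_trans (rS j).
have clusters_at i y q : X y -> nz y q ->
    clusters (r i) (cluster_at zero (r i) (shift_conf q y) 0).
  move=> Xy yq; exists (shift_conf q y); split=> //.
    exact: (almost_minimal_shift Xam).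
  by rewrite nonzero_shift /= add0r.
exists r, (fun i => clusters (r i)); split=> //.
- by move=> i; exact: clusters_finite.
- move=> i _ [y [Xy y0 ->]]; split; first exact: finite_dom_cluster_at.
  exact: cluster_at_r_cluster.
split.
- move=> i _ [y [Xy y0 ->]].
  have [n [q [R [qy Rglue RE]]]] :=
    cluster_at_zero_gluing (ltnW (rS i)) y0 (component_finite (r i.+1) Xy y0).
  exists n, (fun k => cluster_at zero (r i) (shift_conf (q k) y) 0).
  exists (fun k => - q k), R; split=> //; first by move=> k; exact: clusters_at.
  rewrite (_ : (fun k => translate _ _) =
    fun k => cluster_at zero (r i) y (q k)) //.
  by apply/funext => k; rewrite -cluster_at_centred.
- by move=> i _ c [y [Xy y0 ->]] ic; exact: ((fP (r i)).2 y Xy y0).1.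
- move=> i _ [y [Xy y0 ->]]; have [_ [q [yq qr' qr]]] := (fP (r i)).2 y Xy y0.
  (* The shift by 0 makes both clusters instances of [cluster_at_centred]. *)
  exists (cluster_at zero (r i) (shift_conf 0 y) 0).
  exists (cluster_at zero (r i) (shift_conf q y) 0), (- 0), (- q).
  rewrite -!cluster_at_centred !supp_cluster_at //; split.
  + exact: clusters_at.
  + exact: clusters_at.
  + apply: subpattern_restriction; apply: cell_ballS; first exact: ltnW.
    by move=> u; apply: linkS; exact: ltnW.
  + apply: subpattern_restriction; apply: cell_ballS; first exact: ltnW.
    move=> u qu; apply: link_trans qr' _; apply: linkS qu; exact: ltnW.
  + apply/seteqP; split=> // u [u0 uq]; apply: qr.
    by apply: link_trans u0 _; exact: link_sym.
(* Moving the origin back from [p] turns these into the clusters of [x] at [p],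
   and a cell [u] is in the padding as soon as [r j] exceeds its distance
   to [p]. *)
exists (fun=> - p), (fun j => cluster_at zero (r j) (shift_conf p x) 0).
split=> [j|]; first exact: clusters_at.
apply: cvg_agree => W; exists (\max_(u <- W) cell_dist u p)%N => n Wn u uW.
have -> : shift_conf (- p)
      (extend zero (cluster_at zero (r n) (shift_conf p x) 0)) u
    = extend zero (cluster_at zero (r n) x p) u.
  by rewrite [in RHS]cluster_at_centred.
rewrite /extend /cluster_at restriction_in //; exists p; first exact: link_refl.
apply: leq_trans (r_ge n); apply: leq_trans Wn.
exact: (@leq_bigmax_seq _ W xpredT (fun u => cell_dist u p)).
Qed.

End Fractal.

(** * Runs of zeros in dimension one *)

Section OneDimensional.
Context {Sigma : finType} {zero : Sigma} {X : set (conf 1 Sigma)}.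
Hypothesis Xam : almost_minimal X (zero_conf 1 zero).
Local Notation nz := (nonzero zero).

Implicit Types (u v w : cell 1) (s : int).

Definition coord u : int := u ord0 ord0.

Lemma coord_inj : injective coord.
Proof. by move=> u v uv; apply/rowP => i; rewrite !ord1. Qed.

Lemma coordD u v : coord (u + v) = coord u + coord v.
Proof. by rewrite /coord mxE. Qed.

Lemma coord_const a : coord (const_mx a) = a.
Proof. by rewrite /coord mxE. Qed.

Lemma coordMn u k : coord (u *+ k) = coord u *+ k.
Proof. by rewrite /coord mulmxnE. Qed.

Lemma cell_dist_coord u v : cell_dist u v = `|coord u - coord v|%N.
Proof. by rewrite /cell_dist big_ord_recl big_ord0 maxn0. Qed.

Lemma cell_ball_coord N u :
  cell_ball N [set 0] u <-> (`|coord u| <= N)%N.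
Proof.
have c0 : cell_dist u 0 = `|coord u|%N.
  by rewrite cell_dist_coord /coord mxE subr0.
by split=> [[_ -> ]|uN]; [rewrite c0|exists 0 => //; rewrite c0].
Qed.

Lemma sign_cases s : s * s = 1 -> s = 1 \/ s = -1.
Proof.
move=> ss; have : (s == 1) || (s == -1) by rewrite -sqrf_eq1 expr2 ss.
by case/orP => /eqP ->; [left|right].
Qed.

(** The sign [s] selects one of the two half-lines. With [v] and [k] from
[almost_minimal_zero_windows] applied to the window of the cells [s j] for
[1 <= j <= r], the run starts after [m = s v + k], which is nonnegative once
[k] is at least the absolute value of [v]. *)
Lemma zero_run s r x : s * s = 1 -> X x ->
  exists m : nat, forall u,
    m%:Z < s * coord u <= (m + r)%:Z -> x u = zero.
Proof.
move=> ss Xx.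
pose W : seq (cell 1) := [seq const_mx (s * j%:Z) | j <- iota 1 r].
have [v vP] := almost_minimal_zero_windows Xam W (const_mx s) Xx.
have [k vk kW] := vP `|coord v|%N.
have [m mE] : exists m : nat, m%:Z = s * coord v + k%:Z.
  exists `|(s * coord v + k%:Z)%R|%N.
  by case: (sign_cases ss) => ->; lia.
exists m => u /andP[mu um].
have [j jE] : exists j : nat, j%:Z = s * coord u - m%:Z.
  by exists `|(s * coord u - m%:Z)%R|%N; lia.
rewrite -(kW (const_mx (s * j%:Z))).
  congr x; apply: coord_inj; rewrite !coordD coordMn !coord_const jE mE.
  by case: (sign_cases ss) => ->; lia.
apply: (map_f (fun j : nat => const_mx (s * j%:Z) : cell 1)).
by rewrite mem_iota; lia.
Qed.

(** Steps have length at most [r], so a path cannot jump over [r] consecutive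
missing cells. *)
Lemma link_before_run s r S u (m : nat) : s * s = 1 ->
  (forall w, m%:Z < s * coord w <= (m + r)%:Z -> ~ S w) ->
  link r S 0 u -> s * coord u <= m%:Z.
Proof.
move=> ss mS; move: u.
apply: (@link_ind _ _ _ _ (fun u => s * coord u <= m%:Z)) => [|v w vm Sw].
  by rewrite /coord mxE mulr0.
rewrite cell_dist_coord => vw.
rewrite leNgt; apply/negP => mw; apply: (mS w) => //; rewrite mw /=.
by case: (sign_cases ss) => sE; rewrite sE in vm *; lia.
Qed.

(** A point agreeing with [x] on the two runs has its class of the origin confined
by the same runs, so the bound is locally constant. *)
Lemma bounded_components r : exists L, forall x, X x -> nz x 0 ->
  link r (nz x) 0 `<=` cell_ball L [set 0].
Proof.
have Xc : closed X by case: Xam => -[].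
have [|N NP] := @closed_eventually _ _ X
  (fun n x => link r (nz x) 0 `<=` cell_ball n [set 0]) Xc; last first.
  by exists N => x Xx _; exact: NP.
move=> x Xx.
have [a aP] := zero_run (s := 1) r erefl Xx.
have [b bP] := zero_run (s := -1) r erefl Xx.
have /finite_seqP[W WE] := @cell_ball_finite 1 (a + b + r).
have WP u : (`|coord u| <= a + b + r)%N -> u \in W.
  by move=> /cell_ball_coord; rewrite WE.
exists W, (a + b)%N => y n Xy xy abn u yu; apply/cell_ball_coord.
have ua : 1 * coord u <= a%:Z.
  apply: link_before_run yu => // w wa.
  rewrite /nonzero /= xy; first by rewrite aP.
  by apply: WP; lia.
have ub : -1 * coord u <= b%:Z.
  apply: link_before_run yu => // w wb.
  rewrite /nonzero /= xy; first by rewrite bP.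
  by apply: WP; lia.
lia.
Qed.

End OneDimensional.

Theorem theorem1p1 (Sigma : finType) (zero : Sigma) (X : set (conf 1 Sigma))
  (hX : almost_minimal X (zero_conf 1 zero)) :
  exists x : conf 1 Sigma,
    [/\ X x,
        finite_point zero x \/ cluster_fractal zero x
      & X = orbit_closure x].
Proof.
have [[x [Xx xN0 xfin]]|Nfin] := pselect
    (exists x, [/\ X x, x <> zero_conf 1 zero & finite_point zero x]).
  by exists x; split; [|left|rewrite (almost_minimal_transitive hX)].
have [x Xx xN0] := almost_minimal_nonzero hX.
exists x; split=> //; last by rewrite (almost_minimal_transitive hX).
right; apply: (cluster_fractal_of_bounded hX) => //.
  exact: bounded_components.
by move=> y Xy yN0 yfin; apply: Nfin; exists y.
Qed.
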